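(* Let $f,g\colon I\to I$ be piecewise monotone maps of $I=[0,1]$, with $f$ surjective, such that $g\circ f^{-1}=f^{-1}\circ g$ (as set-valued functions on $I$). Then $$\mathrm{Ent}(g\circ f^{-1})=\max\{\mathrm{Ent}(f),\mathrm{Ent}(g)\}.$$
   Context: A continuous map $f\colon I\to I$ is piecewise monotone if there are points $0=c_0<c_1<\cdots<c_N=1$ such that $f|_{[c_i,c_{i+1}]}$ is one-to-one for each $i$. $g\circ f^{-1}$ is $x\mapsto g(f^{-1}(\{x\}))$ and $f^{-1}\circ g$ is $x\mapsto f^{-1}(\{g(x)\})$. Entropy of a set-valued function $F\colon X\to 2^X$ with closed graph on a compact metric space $(X,d_X)$, where $2^X$ is the set of non-empty closed subsets (a continuous map is regarded as a set-valued function with singleton values): an $n$-orbit is a tuple $(x_1,\ldots,x_n)$ with $x_{i+1}\in F(x_i)$ for $1\le i<n$; $Orb_n(F)$ is the set of $n$-orbits. $S\subset Orb_n(F)$ is $(n,\varepsilon)$-separated if for any two distinct elements $(x_i),(y_i)$ of $S$ there is $i$ with $d_X(x_i,y_i)>\varepsilon$. With $s_{n,\varepsilon}(F)$ the largest cardinality of an $(n,\varepsilon)$-separated set, $\mathrm{Ent}(F)=\lim_{\varepsilon\to 0}\limsup_{n\to\infty}\frac1n\log s_{n,\varepsilon}(F)$. *)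

(* Defs.v *)
From HB Require Import structures.
From mathcomp Require Import all_boot all_order all_algebra.
From mathcomp Require Import all_classical all_reals all_analysis.

Set Implicit Arguments.
Unset Strict Implicit.
Unset Printing Implicit Defensive.

Import Order.TTheory GRing.Theory Num.Theory.
Import numFieldNormedType.Exports.

Local Open Scope classical_set_scope.
Local Open Scope card_scope.
Local Open Scope ring_scope.

Section entropy.
Context {R : realType} {X : metricType R}.

(* A set-valued function is F : X -> set X. The definitions below make sense
   for every F; having non-empty closed values and a closed graph is a property
   of the F they are applied to. *)

Definition n_orbits (F : X -> set X) (n : nat) : set (n.-tuple X) :=
  [set x | forall i j : 'I_n, j = i.+1 :> nat -> F (tnth x i) (tnth x j)].
#[global] Arguments n_orbits F n : clear implicits.

Definition eps_separated (F : X -> set X) (n : nat) (eps : R)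
    (S : set (n.-tuple X)) : Prop :=
  S `<=` n_orbits F n /\
  forall x y, S x -> S y -> x <> y ->
    exists i : 'I_n, eps < mdist (tnth x i) (tnth y i).

(* Valued in \bar R, so that it is +oo if the cardinalities are unbounded. *)
Definition max_separated (F : X -> set X) (n : nat) (eps : R) : \bar R :=
  ereal_sup [set k%:R%:E | k in
    [set k : nat | exists2 S : set (n.-tuple X), eps_separated F eps S & S #= `I_k]].

Definition entropy (F : X -> set X) : \bar R :=
  lim (limn_esup (fun n => (n%:R^-1)%:E * lne (max_separated F n eps))%E
       @[eps --> 0^'+]).

End entropy.

Definition setfun {X Y : Type} (f : X -> Y) : X -> set Y :=
  fun x => [set f x].

Definition setfun_comp_inv {X Y Z : Type} (g : X -> Z) (f : X -> Y) : Y -> set Z :=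
  fun y => g @` (f @^-1` [set y]).

Definition setfun_inv_comp {X Y Z : Type} (f : X -> Z) (g : Y -> Z) : Y -> set X :=
  fun y => f @^-1` [set g y].

Definition unit_itv (R : realType) : Type := `[0 : R, 1]%classic.

Section unit_itv_metric.
Context (R : realType).

HB.instance Definition _ :=
  PseudoMetric.copy (unit_itv R) (set_type `[0 : R, 1]%classic).

Let dist (x y : unit_itv R) : R := `|\val x - \val y|.

Let dist_ge0 x y : 0 <= dist x y.
Proof. exact: normr_ge0. Qed.

Let dist_positivity x y : dist x y = 0 -> x = y.
Proof. by move=> /normr0_eq0/eqP; rewrite subr_eq0 => /eqP/val_inj. Qed.

Let ballEdist (x : unit_itv R) (d : R) : ball x d = [set y | dist x y < d].
Proof. by []. Qed.

HB.instance Definition _ := @PseudoMetric_isMetric.Build R (unit_itv R)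
  dist dist_ge0 dist_positivity ballEdist.

End unit_itv_metric.

Definition piecewise_monotone {R : realType}
    (f : unit_itv R -> unit_itv R) : Prop :=
  continuous f /\
  exists (N : nat) (c : nat -> R),
    [/\ c 0%N = 0, c N = 1,
        forall i, (i < N)%N -> c i < c i.+1 &
        forall i, (i < N)%N ->
          set_inj [set x : unit_itv R | c i <= \val x <= c i.+1] f].

(* Main.v *)
(* By strong commutation the (n+1)-orbits of [g o f^-1] are exactly the
   antidiagonals [(f^n z, f^(n-1) g z, ..., g^n z)], and both sides of the
   identity are read off from the exponential growth of the largest fibers of
   the iterates of [f] and [g].

   Upper bound: two e-separated antidiagonals z < z' have a coordinate
   [f^(n-i) g^i] that takes some multiple of e strictly between z and z', so the
   separated sets are interlaced with the fibers over these multiples and have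
   at most 1 + (1/e + 1) sum_i N(f^(n-i)) N(g^i) elements, where N is the largest
   cardinality of a fiber.

   Lower bound: a fiber of g^n over f^n p lifts to as many orbits ending at p.
   For e small, the laps of g^k make at most two points of an e-ball have
   the same image under g^k, hence at most 2^(n/k+1) of these orbits are e-close
   to each other; letting k grow removes this factor. For f the roles are
   exchanged, but g need not be onto: points outside g^n(I) are handled by
   pushing the fiber forward by a fixed iterate g^m, after which f has no fold
   outside the intersection of all the g^n(I).

   The same two estimates applied to (id, f) and (id, g) compute Ent(f) and
   Ent(g). *)

Require Import Defs.
From mathcomp Require Import all_boot all_order all_algebra.
From mathcomp Require Import all_classical all_reals all_analysis.
From mathcomp Require Import ring lra zify.

Set Implicit Arguments.
Unset Strict Implicit.
Unset Printing Implicit Defensive.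

Import Order.TTheory GRing.Theory Num.Theory.
Import numFieldNormedType.Exports.

Local Open Scope classical_set_scope.
Local Open Scope card_scope.
Local Open Scope ring_scope.

(** * Counting in finite lists *)

Lemma size_le_sum_fibers (R : numDomainType) (T U : eqType) (h : T -> U)
    (B : U -> R) (t : seq U) (s : seq T) :
  {in s, forall u, h u \in t} ->
  {in t, forall v, (count (fun u => h u == v) s)%:R <= B v} ->
  (size s)%:R <= \sum_(v <- t) B v.
Proof.
elim: t s => [|v t IH] s ht hB.
  case: s ht {hB} => [|u s] ht; first by rewrite big_nil.
  by have := ht u (mem_head _ _).
rewrite big_cons -(count_predC (fun u => h u == v) s) natrD lerD//.
  by rewrite hB// mem_head.
rewrite -size_filter IH// => [u|w wt].
  by rewrite mem_filter /= => /andP[huv /ht]; rewrite inE (negbTE huv).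
rewrite (le_trans _ (hB w _))//; last by rewrite inE wt orbT.
by rewrite ler_nat count_filter; apply: sub_count => u /= /andP[].
Qed.

(** An element enters [t] only when nothing already in [t] is close to it. Since [close] need not be
    transitive, such a list stands in for a choice of class representatives. *)
Lemma greedy_separated (T : eqType) (close : rel T) (s : seq T) :
  reflexive close -> symmetric close -> uniq s ->
  exists t : seq T, [/\ uniq t, {subset t <= s},
    {in t &, forall u v, u != v -> ~~ close u v} &
    {in s, forall u, exists2 v, v \in t & close u v}].
Proof.
move=> cxx csym; elim: s => [|x s IH] /=; first by exists [::].
move=> /andP[xs /IH [t [ut ts tsep tcov]]].
case: (boolP (has (close x) t)) => [/hasP[v vt xv]|/hasPn xt].
  exists t; split => // [u /ts us|u]; first by rewrite inE us orbT.
  by rewrite inE => /orP[/eqP ->|/tcov//]; exists v.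
exists (x :: t); split => /= [|u|u v|u].
- by rewrite ut andbT; apply: contra xs => /ts.
- by rewrite !inE => /orP[->//|/ts ->]; rewrite orbT.
- rewrite !inE => /orP[/eqP ->|ut1] /orP[/eqP ->|vt1]; rewrite ?eqxx//.
  + by move=> _; exact: xt.
  + by move=> _; rewrite csym; exact: xt.
  + exact: tsep.
- rewrite inE => /orP[/eqP ->|/tcov[v vt uv]].
    by exists x; rewrite ?mem_head.
  by exists v; rewrite // inE vt orbT.
Qed.

(** If no list exhausted [P], fresh elements could be added one at a time until a duplicate-free
    list of length [m.+1] broke the bound. *)
Lemma bounded_enum (T : eqType) (P : T -> Prop) m :
  (forall s : seq T, uniq s -> {in s, forall x, P x} -> (size s <= m)%N) ->
  exists W : seq T, forall x, P x -> x \in W.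
Proof.
move=> Pm; apply: contrapT => nW.
suff [s [us sP sm]] : exists s : seq T, [/\ uniq s, {in s, forall x, P x} & size s = m.+1].
  by have := Pm s us sP; rewrite sm ltnn.
elim: m.+1 => [|k [s [us sP sk]]]; first by exists [::].
have [x xP xs] : exists2 x, P x & x \notin s.
  apply: contrapT => nx; apply: nW; exists s => x xP; apply: contrapT => /negP xs.
  by apply: nx; exists x.
exists (x :: s); split => /=; [by rewrite xs|move=> y|by rewrite sk].
by rewrite inE => /orP[/eqP ->|/sP].
Qed.

(** * Order, intermediate values and folds on the unit interval *)

Section UnitInterval.
Variable R : realType.
Implicit Types (x y z u v w c : unit_itv R) (f g phi psi : unit_itv R -> unit_itv R).
Implicit Types (s t W C : seq (unit_itv R)).

Definition between u v w := \val u < \val w < \val v.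

Lemma val_unit_itv u : 0 <= \val u <= 1.
Proof. by have := set_valP u; rewrite /= in_itv. Qed.

Lemma total_unit_itv u v : u <> v -> \val u < \val v \/ \val v < \val u.
Proof. by case: (ltgtP (\val u) (\val v)) => [||/val_inj]; [left|right|]. Qed.

(** The rank of [u], the number of entries of [W] below it, increases strictly along [s] and takes
    at most [(size W).+1] values. *)
Lemma size_interlaced s W : uniq s ->
  {in s &, forall u v, \val u < \val v -> exists2 w, w \in W & between u v w} ->
  (size s <= (size W).+1)%N.
Proof.
move=> us sW; pose r u := count (fun w => \val w < \val u) W.
have rlt u v : u \in s -> v \in s -> \val u < \val v -> (r u < r v)%N.
  move=> uI vI uv; have [w wW /andP[uw wv]] := sW u v uI vI uv.
  pose F := [seq w <- W | \val w < \val v].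
  have -> : r u = count (fun w => \val w < \val u) F.
    rewrite count_filter; apply: eq_count => w' /=.
    by case: (ltP (\val w') (\val u)) => //= /lt_trans ->.
  have -> : r v = size F by rewrite /r -size_filter.
  rewrite -(count_predC (fun w => \val w < \val u) F).
  rewrite -[ltnLHS]addn0 ltn_add2l -has_count; apply/hasP; exists w.
    by rewrite mem_filter wv.
  by rewrite /= -leNgt ltW.
have ruq : uniq (map r s).
  rewrite map_inj_in_uniq// => u v uI vI ruv; apply: contrapT => /total_unit_itv.
  by case=> /rlt => /(_ ltac:(by []) ltac:(by [])); rewrite ruv ltnn.
rewrite -(size_map r) -(size_iota 0 (size W).+1); apply: uniq_leq_size => // _ /mapP[u _ ->].
by rewrite mem_iota/= add0n ltnS count_size.
Qed.

Fact clamp_proof (r : R) : Num.max 0 (Num.min 1 r) \in `[0 : R, 1]%classic.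
Proof.
by apply/mem_set; rewrite /= in_itv /= le_max lexx ge_max ler01 ge_min lexx.
Qed.

(** A 1-Lipschitz retraction of the line onto the interval, through which the intermediate value
    theorem on the line reaches maps of [unit_itv R]. *)
Definition clamp (r : R) : unit_itv R := exist (fun x : R => x \in `[0 : R, 1]%classic) _ (clamp_proof r).

Lemma val_clamp r : 0 <= r <= 1 -> \val (clamp r) = r.
Proof. by move=> /andP[r0 r1]; rewrite /= (min_idPr r1) (max_idPr r0). Qed.

Lemma clampK u : clamp (\val u) = u.
Proof. by apply: val_inj; rewrite val_clamp// val_unit_itv. Qed.

Lemma clamp_dist r r' : `|\val (clamp r) - \val (clamp r')| <= `|r - r'|.
Proof.
have := ler_norm (r - r'); have := ler_norm (r' - r); rewrite (distrC r' r) ler_norml /=.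
move: `|r - r'| => d d1 d2.
by case: (leP 1 r) (leP 1 r') (leP 0 r) (leP 0 r') (leP (0 : R) 1)
  => ? [] ? [] ? [] ? [] ?; apply/andP; lra.
Qed.

Lemma unit_itv_continuous_val_clamp phi : continuous phi ->
  continuous (fun r => \val (phi (clamp r)) : R).
Proof.
move=> cphi r; apply/cvgrPdist_lt => e e0.
have := cphi (clamp r) _ (nbhsx_ballx (phi (clamp r)) e e0).
move=> /nbhs_ballP[d /= d0 hd].
apply/nbhs_ballP; exists d => // r' /= rr'.
apply: hd; apply: (le_lt_trans _ rr'); exact: clamp_dist.
Qed.

Lemma unit_itv_ivt phi u v (r : R) : continuous phi -> \val u < \val v ->
  Num.min (\val (phi u)) (\val (phi v)) < r < Num.max (\val (phi u)) (\val (phi v)) ->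
  exists2 w, between u v w & \val (phi w) = r.
Proof.
move=> cphi uv /andP[r1 r2].
have cF := unit_itv_continuous_val_clamp cphi.
have [||c] := @IVT R (fun r => \val (phi (clamp r))) (\val u) (\val v) r (ltW uv).
- exact: continuous_subspaceT.
- by rewrite !clampK (ltW r1) (ltW r2).
rewrite in_itv /= => /andP[uc cv] cr.
have cE : \val (clamp c) = c.
  have /andP[? _] := val_unit_itv u; have /andP[_ ?] := val_unit_itv v.
  by rewrite val_clamp// (le_trans _ uc)// (le_trans cv).
have [ru rv] : r <> \val (phi u) /\ r <> \val (phi v).
  split=> e; move: r1 r2; rewrite e lt_max gt_min ltxx ?orbF /=.
    by move=> /lt_trans h /h; rewrite ltxx.
  by move=> h /lt_trans /(_ h); rewrite ltxx.
exists (clamp c) => //; rewrite /between cE !lt_neqAle uc cv !andbT.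
apply/andP; split; apply/eqP => e.
  by apply: ru; rewrite -cr -e clampK.
by apply: rv; rewrite -cr e clampK.
Qed.

(** [C] is a finite list of possible folds. Only folds strictly between [u] and [v] are excluded, so
    injectivity holds on closed laps. *)
Definition injective_off C phi := forall u v, \val u < \val v ->
  {in C, forall c, ~~ between u v c} -> phi u <> phi v.

Lemma piecewise_monotone_injective_off phi :
  piecewise_monotone phi -> exists C, injective_off C phi.
Proof.
move=> [_ [N [c [c0 cN cS cinj]]]].
exists [seq clamp (c i) | i <- iota 0 N.+1] => u v uv uvC.
have [/andP[u0 _] /andP[_ v1]] := (val_unit_itv u, val_unit_itv v).
have [i iN /andP[ciu uci]] : exists2 i, (i < N)%N & c i <= \val u < c i.+1.
  have : \val u < c N by rewrite cN (lt_le_trans uv).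
  elim: (N) => [|M IH] uM; first by move: uM; rewrite c0 ltNge u0.
  have [cu|/IH[i iM ?]] := leP (c M) (\val u); first by exists M; rewrite ?cu.
  by exists i => //; exact: ltnW.
have vci : \val v <= c i.+1.
  rewrite leNgt; apply/negP => civ.
  have : clamp (c i.+1) \in [seq clamp (c i) | i <- iota 0 N.+1].
    by apply/mapP; exists i.+1 => //; rewrite mem_iota.
  move/uvC/negP; apply; rewrite /between val_clamp ?uci//.
  by rewrite (le_trans u0 (ltW uci)) (le_trans (ltW civ)).
move=> uvE; suff e : u = v by rewrite e ltxx in uv.
apply: (cinj i iN) => //; apply/mem_set => /=.
  by rewrite ciu (le_trans (ltW uv)).
by rewrite vci (le_trans ciu)// ltW.
Qed.

Lemma injective_off_fiber C phi s : injective_off C phi -> uniq s ->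
  {in s &, forall u v, phi u = phi v} -> (size s <= (size C).+1)%N.
Proof.
move=> Cphi us sphi; apply: size_interlaced => // u v uI vI uv.
apply: contrapT => nC; apply: (Cphi u v uv _ (sphi u v uI vI)) => c cC.
by apply/negP => uvc; apply: nC; exists c.
Qed.

(** The new folds are those of [phi] and the [phi]-preimages of those of [psi], finitely many
    because fibers of [phi] are finite. A fold of [psi] between [phi u] and [phi v] would yield such
    a preimage between [u] and [v]. *)
Lemma injective_off_comp C D phi psi : continuous phi ->
  injective_off C phi -> injective_off D psi ->
  exists E, injective_off E (psi \o phi).
Proof.
move=> cphi Cphi Dpsi.
have /choice[W WP] d : exists W, forall w, phi w = d -> w \in W.
  apply: (@bounded_enum _ _ (size C).+1) => s us sd.
  by apply: (injective_off_fiber Cphi) => // u v /sd -> /sd ->.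
exists (C ++ flatten [seq W d | d <- D]) => u v uv uvE.
have phiuv : phi u <> phi v.
  by apply: Cphi => // c cC; apply: uvE; rewrite mem_cat cC.
have uvD d : d \in D ->
    ~ Num.min (\val (phi u)) (\val (phi v)) < \val d < Num.max (\val (phi u)) (\val (phi v)).
  move=> dD /(unit_itv_ivt cphi uv)[w uvw /val_inj wd].
  have := uvE w; rewrite uvw mem_cat => /(_ _)/negP/(_ isT); apply.
  by apply/orP; right; apply/flattenP; exists (W d); [exact: map_f|exact: WP].
case: (total_unit_itv phiuv) => [lt|lt].
  apply: Dpsi => // d dD; apply/negP => ?; apply: (uvD d dD).
  by rewrite (min_idPl (ltW lt)) (max_idPr (ltW lt)).
apply: nesym; apply: Dpsi => // d dD; apply/negP => ?; apply: (uvD d dD).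
by rewrite (min_idPr (ltW lt)) (max_idPl (ltW lt)).
Qed.

Lemma continuous_iter phi n : continuous phi -> continuous (iter n phi).
Proof.
move=> cphi; elim: n => [|n IH] u; first exact: cvg_id.
exact: (@continuous_comp _ _ _ (iter n phi) phi u (IH u) (cphi _)).
Qed.

Lemma injective_off_iter C phi n : continuous phi -> injective_off C phi ->
  exists D, injective_off D (iter n phi).
Proof.
move=> cphi Cphi; elim: n => [|n [D IH]].
  by exists [::] => u v uv _ /= uvE; move: uv; rewrite uvE ltxx.
exact: (injective_off_comp (continuous_iter (n := n) cphi) IH Cphi).
Qed.

Lemma ordered_triple s : uniq s -> (2 < size s)%N ->
  exists u v w, [/\ u \in s, v \in s, w \in s, \val u < \val v & \val v < \val w].
Proof.
case: s => [|a[|b[|c s]]]//= us _.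
have [ab bc ca] : [/\ a <> b, b <> c & c <> a].
  move: us; rewrite !inE !negb_or => /and4P[/and3P[/eqP ? /eqP ? _] /andP[/eqP ? _] _ _].
  by split => //; apply: nesym.
have [aI [bI cI]] : a \in [:: a, b, c & s] /\ b \in [:: a, b, c & s] /\ c \in [:: a, b, c & s].
  by rewrite !inE !eqxx ?orbT.
case: (total_unit_itv ab) (total_unit_itv bc) (total_unit_itv ca) => [?|?] [?|?] [?|?].
all: try solve [by exists a, b, c|by exists a, c, b|by exists b, a, c|by exists b, c, a
  |by exists c, a, b|by exists c, b, a|lra].
Qed.

Definition two_to_one_within (e : R) phi := forall s, uniq s ->
  {in s &, forall u v, phi u = phi v /\ `|\val u - \val v| <= e} -> (size s <= 2)%N.

(** Three points of a fiber enclose two distinct folds, which is impossible at distances below the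
    smallest gap between folds. *)
Lemma injective_off_two_to_one C phi : injective_off C phi ->
  exists2 e, 0 < e & two_to_one_within e phi.
Proof.
move=> Cphi.
have [e e0 Ce] : exists2 e : R, 0 < e &
    {in C &, forall c d, \val c < \val d -> e <= \val d - \val c}.
  elim: (C) => [|c D [e e0 IH]]; first by exists 1.
  have [e' e'0 De'] : exists2 e' : R, 0 < e' &
      {in D, forall d, d <> c -> e' <= `|\val d - \val c|}.
    elim: D {IH} => [|d D [e' e'0 IH]]; first by exists 1.
    have [->|/eqP dc] := eqVneq d c.
      by exists e' => // x; rewrite inE => /orP[/eqP ->|/IH].
    have dc' : 0 < `|\val d - \val c|.
      by rewrite normr_gt0 subr_eq0; apply/eqP => /val_inj.
    exists (Num.min e' `|\val d - \val c|); first by rewrite lt_min e'0.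
    move=> x; rewrite inE => /orP[/eqP -> _|xD xc]; first by rewrite ge_min lexx orbT.
    by rewrite ge_min IH.
  exists (Num.min e e'); first by rewrite lt_min e0.
  move=> x y; rewrite !inE => /orP[/eqP ->|xD] /orP[/eqP ->|yD] xy.
  - by rewrite ltxx in xy.
  - rewrite ge_min -[X in _ || (_ <= X)]gtr0_norm ?subr_gt0// De' ?orbT// => yc.
    by rewrite yc ltxx in xy.
  - rewrite ge_min -[X in _ || (_ <= X)]gtr0_norm ?subr_gt0// distrC De' ?orbT// => yc.
    by rewrite yc ltxx in xy.
  - by rewrite ge_min IH.
exists (e / 2); first by rewrite divr_gt0.
move=> s us sphi; rewrite leqNgt; apply/negP.
move=> /(ordered_triple us)[u [v [w [uI vI wI uv vw]]]].
have sep x y : x \in s -> y \in s -> \val x < \val y -> exists2 c, c \in C & between x y c.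
  move=> xI yI xy; apply: contrapT => nC.
  apply: (Cphi x y xy _ (sphi x y xI yI).1) => c cC.
  by apply/negP => xyc; apply: nC; exists c.
have [c cC /andP[uc cv]] := sep u v uI vI uv.
have [d dC /andP[vd dw]] := sep v w vI wI vw.
have := Ce c d cC dC (lt_trans cv vd).
have := (sphi u w uI wI).2; rewrite distrC ger0_norm; last by lra.
lra.
Qed.
End UnitInterval.

(** * Cardinality of fibers *)

Definition fiber_bound (R : numDomainType) (T U : eqType) (phi : T -> U) (A : R) :=
  forall s : seq T, uniq s -> {in s &, forall u v, phi u = phi v} -> (size s)%:R <= A.

Lemma fiber_bound_count (R : numDomainType) (T U : eqType) (phi : T -> U) (A : R) v s :
  fiber_bound phi A -> uniq s -> (count (fun u => phi u == v) s)%:R <= A.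
Proof.
move=> phiA us; rewrite -size_filter; apply: phiA; first exact: filter_uniq.
by move=> x y; rewrite !mem_filter => /andP[/eqP -> _] /andP[/eqP -> _].
Qed.

Lemma fiber_bound_size (R : numDomainType) (T U : eqType) (phi : T -> U) (A : R) s :
  fiber_bound phi A -> uniq s -> (size s)%:R <= A * (size (undup (map phi s)))%:R.
Proof.
move=> phiA us.
have /le_trans -> // : (size s)%:R <= \sum_(v <- undup (map phi s)) A.
  apply: (size_le_sum_fibers (h := phi)) => [u uI|v _].
    by rewrite mem_undup map_f.
  exact: fiber_bound_count.
by rewrite big_const_seq count_predT iter_addr_0 mulr_natr.
Qed.

Lemma fiber_bound_comp (R : numDomainType) (T U V : eqType) (phi : T -> U) (psi : U -> V)
    (A B : R) : 0 <= A ->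
  fiber_bound phi A -> fiber_bound psi B -> fiber_bound (psi \o phi) (A * B).
Proof.
move=> A0 phiA psiB s us sE; apply: (le_trans (fiber_bound_size phiA us)).
apply: ler_wpM2l => //; apply: psiB; first exact: undup_uniq.
by move=> _ _ /[!mem_undup] /mapP[u uI ->] /mapP[v vI ->]; exact: sE.
Qed.

(** * Strong commutation and antidiagonals *)

Definition strongly_commute (T : Type) (f g : T -> T) :=
  (forall x, f (g x) = g (f x)) /\
  (forall y z, g y = f z -> exists x, f x = y /\ g x = z).

Section StronglyCommute.
Variable T : Type.
Implicit Types f g : T -> T.

(** Each clause is one inclusion between the two set-valued maps. The second clause completes any
    [y], [z] with [g y = f z] to a commuting square. *)
Lemma setfun_comp_inv_strongly_commute f g :
  setfun_comp_inv g f = setfun_inv_comp f g -> strongly_commute f g.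
Proof.
move=> fg; split=> [x|y z yz].
  have : setfun_comp_inv g f (f x) (g x) by exists x.
  by rewrite fg.
have : setfun_inv_comp f g y z by rewrite /setfun_inv_comp/= yz.
by rewrite -fg => -[x /= fx gx]; exists x.
Qed.

Lemma strongly_commute_sym f g : strongly_commute f g -> strongly_commute g f.
Proof.
move=> [comm lift]; split=> [x|y z yz]; first by rewrite comm.
by have [x [fx gx]] := lift z y (esym yz); exists x.
Qed.

Lemma strongly_commute_id g : strongly_commute id g.
Proof. by split=> // y z yz; exists y. Qed.

(** Completed squares are pasted side by side. *)
Lemma strongly_commute_iterl n f g :
  strongly_commute f g -> strongly_commute (iter n f) g.
Proof.
move=> [comm lift]; elim: n => [|n [IHc IHl]]; first exact: strongly_commute_id.
split=> [x|y z /= yz]; first by rewrite /= IHc comm.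
by have [x1 [<- /IHl[x [<- <-]]]] := lift _ _ yz; exists x.
Qed.

Lemma strongly_commute_iter m n f g :
  strongly_commute f g -> strongly_commute (iter m f) (iter n g).
Proof.
move=> fg; apply/strongly_commute_sym/strongly_commute_iterl.
exact/strongly_commute_sym/strongly_commute_iterl.
Qed.

Definition antidiagonal f g n z i := iter (n - i) f (iter i g z).

(** Both sides are [f^(n-i) g^(i+r) z]. Entry [i] is thus known from entry [i + r] up to a fiber of
    [iter r g]. *)
Lemma antidiagonal_iter f g n z i r : strongly_commute f g -> (i + r <= n)%N ->
  iter r g (antidiagonal f g n z i) = iter r f (antidiagonal f g n z (i + r)).
Proof.
move=> fg irn; rewrite /antidiagonal -(strongly_commute_iter (n - i) r fg).1.
by rewrite -!iterD addnC; congr (iter _ f _); lia.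
Qed.

Lemma antidiagonal_rev f g n z i : strongly_commute f g -> (i <= n)%N ->
  antidiagonal f g n z i = antidiagonal g f n z (n - i).
Proof.
by move=> fg iN; rewrite /antidiagonal subKn// (strongly_commute_iter _ _ fg).1.
Qed.

(** Choose [y i] with [f (y i) = x i] and [g (y i) = x i.+1]. Then [g (y i) = f (y i.+1)], so strong
    commutation makes [y] an orbit with one term less, and its [z] serves for [x] as well. *)
Lemma setfun_comp_inv_orbit f g n (x : nat -> T) : strongly_commute f g ->
  (forall i, (i < n)%N -> setfun_comp_inv g f (x i) (x i.+1)) ->
  exists z, forall i, (i <= n)%N -> x i = antidiagonal f g n z i.
Proof.
move=> fg; elim: n x => [|n IH] x orb.
  by exists (x 0%N) => i; rewrite leqn0 => /eqP ->.
have /choice[y yP] i : exists y, (i <= n)%N -> f y = x i /\ g y = x i.+1.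
  have [iN|] := leqP i n; last by exists (x 0%N).
  by have [y /= fy gy] := orb i iN; exists y.
have [|z zP] := IH y.
  move=> i iN.
  have [_ gi] := yP i (ltnW iN); have [fi _] := yP i.+1 iN.
  by have [w [fw gw]] := fg.2 (y i) (y i.+1) (etrans gi (esym fi)); exists w.
exists z => i; rewrite leq_eqVlt => /orP[/eqP ->|].
  have [_ <-] := yP n (leqnn n).
  by rewrite zP// /antidiagonal !subnn.
rewrite ltnS => iN; have [<- _] := yP i iN.
by rewrite zP// /antidiagonal subSn.
Qed.

Lemma antidiagonal_orbit f g n z i : strongly_commute f g -> (i < n)%N ->
  setfun_comp_inv g f (antidiagonal f g n z i) (antidiagonal f g n z i.+1).
Proof.
move=> fg iN; exists (iter (n - i.+1) f (iter i g z)) => /=.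
  by rewrite -iterS /antidiagonal -subSn.
by rewrite /antidiagonal iterS (strongly_commute_iterl _ fg).1.
Qed.

End StronglyCommute.

(** * Separated families of antidiagonals with a common end *)

Section Clusters.
Variable R : realType.
Implicit Types (z u v p : unit_itv R) (f g : unit_itv R -> unit_itv R).
Implicit Types (s t : seq (unit_itv R)) (e : R).

(* Since g^k x_i = f^k x_(i+k), the entries of index n, n-k, n-2k, ... of close
   antidiagonals are each determined by the previous one up to two choices; the
   last step, down to index 0, may be shorter than k. *)
Lemma size_cluster f g k e n s p : strongly_commute f g -> (0 < k)%N ->
  two_to_one_within e (iter k g) -> uniq s ->
  {in s, forall z, iter n g z = p} -> {in s &, injective (iter n f)} ->
  {in s &, forall u v i, (i <= n)%N ->
     `|\val (antidiagonal f g n u i) - \val (antidiagonal f g n v i)| <= e} ->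
  (size s <= 2 ^ (n %/ k).+1)%N.
Proof.
move=> fg k0 g2 us sp sinj sclose.
pose V m := undup [seq antidiagonal f g n z (n - m * k) | z <- s].
have sizeV m : (size (V m) <= 2 ^ m)%N.
  elim: m => [|m IH].
    suff : {subset V 0%N <= [:: p]} by move=> /(uniq_leq_size (undup_uniq _)).
    move=> _ /[!mem_undup] /mapP[z zI ->].
    by rewrite mul0n subn0 /antidiagonal subnn /= inE sp.
  pose r := ((n - m * k) - (n - m.+1 * k))%N.
  have rk : (r <= k)%N by rewrite /r mulSn; lia.
  have nr : (n - m.+1 * k + r = n - m * k)%N by rewrite /r mulSn; lia.
  pose W := map (iter r f) (V m).
  suff : (size (V m.+1))%:R <= \sum_(v <- W) 2 :> R.
    rewrite big_const_seq count_predT iter_addr_0 -mulrnA ler_nat size_map => /leq_trans -> //.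
    by rewrite expnS leq_mul2l IH.
  apply: (size_le_sum_fibers (h := iter r g)) => [_ /[!mem_undup] /mapP[z zI ->]|v _].
    rewrite antidiagonal_iter// nr ?leq_subr//.
    by apply: map_f; rewrite mem_undup; apply/mapP; exists z.
  rewrite ler_nat -size_filter; apply: g2; first exact/filter_uniq/undup_uniq.
  move=> x y; rewrite !mem_filter !mem_undup => /andP[/eqP gx /mapP[a aI ax]].
  move=> /andP[/eqP gy /mapP[b bI yb]]; split.
    (* As [r <= k], agreement under [iter r g] gives agreement under [iter k g], to which the
       two-to-one hypothesis applies. *)
    by rewrite -(subnK rk) !iterD gx gy.
  by rewrite ax yb sclose// leq_subr.
have := sizeV (n %/ k).+1; apply: leq_trans.
(* After [(n %/ k).+1] steps index 0 is reached; the entry there is [iter n f z], which determines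
   [z] in [s]. *)
have nk : (n - (n %/ k).+1 * k = 0)%N by apply/eqP; rewrite subn_eq0 ltnW// ltn_ceil.
rewrite /V nk undup_id ?size_map// map_inj_in_uniq// => x y xI yI.
by rewrite /antidiagonal subn0 /=; exact: sinj.
Qed.

(** Extract an e-separated [t] from [s] greedily. Elements of [s] attached to the same member of [t]
    are within [e + e] of each other, so [size_cluster] bounds their number. *)
Lemma size_separated f g k e n s p : strongly_commute f g -> (0 < k)%N ->
  two_to_one_within (e + e) (iter k g) -> uniq s ->
  {in s, forall z, iter n g z = p} -> {in s &, injective (iter n f)} ->
  exists t, [/\ uniq t,
    {in t &, forall u v, u != v -> exists2 i, (i <= n)%N &
       e < `|\val (antidiagonal f g n u i) - \val (antidiagonal f g n v i)|} &
    (size s <= 2 ^ (n %/ k).+1 * size t)%N].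
Proof.
move=> fg k0 g2 us sp sinj.
have [e0|e0] := ltP e 0.
  exists s; split => // [u v uI vI _|]; last by rewrite leq_pmull// expn_gt0.
  by exists 0%N => //; rewrite (lt_le_trans e0).
pose close u v := [forall i : 'I_n.+1,
  `|\val (antidiagonal f g n u i) - \val (antidiagonal f g n v i)| <= e].
have cxx : reflexive close by move=> u; apply/forallP => i; rewrite subrr normr0.
have csym : symmetric close.
  by move=> u v; apply/forallP/forallP => h i; rewrite distrC.
have [t [ut ts tsep tcov]] := greedy_separated cxx csym us.
exists t; split => // [u v uI vI uv|].
  have := tsep u v uI vI uv; rewrite negb_forall => /existsP[i].
  by rewrite -ltNge => ei; exists i => //; rewrite -ltnS.
have /choice[h hP] u : exists v, u \in s -> v \in t /\ close u v.
  by have [/tcov[v vt uv]|us'] := boolP (u \in s); [exists v|exists u].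
suff : (size s)%:R <= \sum_(v <- t) (2 ^ (n %/ k).+1)%:R :> R.
  by rewrite big_const_seq count_predT iter_addr_0 -mulrnA ler_nat.
apply: (size_le_sum_fibers (h := h)) => [u /hP[]//|v _].
rewrite ler_nat -size_filter.
have sub u : u \in [seq u <- s | h u == v] -> u \in s /\ close u v.
  by rewrite mem_filter => /andP[/eqP <- uI]; split => //; apply: (hP u uI).2.
apply: (size_cluster (p := p) fg k0 g2); first exact: filter_uniq.
- by move=> z /sub[/sp].
- by move=> x y /sub[xI _] /sub[yI _]; exact: sinj.
- move=> x y /sub[xI /forallP xv] /sub[yI /forallP yv] i iN.
  have := xv (Ordinal (iN : (i < n.+1)%N)); have := yv (Ordinal (iN : (i < n.+1)%N)).
  rewrite /= => yvi xvi.
  rewrite (le_trans (ler_distD (\val (antidiagonal f g n v i)) _ _))//.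
  by rewrite lerD// distrC.
Qed.
End Clusters.

(** * Finite cardinalities and multiples of [e] *)

Lemma card_eq_uniq (T : eqType) (s : seq T) : uniq s -> [set` s] #= `I_(size s).
Proof.
elim: s => [|x s IH] /=; first by rewrite set_nil II0.
move=> /andP[xs us]; apply/eq_cardSP; exists x; first by rewrite /= mem_head.
suff -> : [set` x :: s] `\ x = [set` s] by exact: IH.
apply/seteqP; split=> y /=; rewrite inE.
  by case=> /orP[/eqP ->|//] /(_ erefl).
by move=> ys; rewrite ys orbT; split => // yx; rewrite -yx ys in xs.
Qed.

Lemma uniq_card_eq (T : eqType) (S : set T) k : S #= `I_k ->
  exists s : seq T, [/\ uniq s, size s = k & {in s, forall x, S x}].
Proof.
elim: k S => [|k IH] S; first by exists [::].
move=> /eq_cardSP[x Sx /IH[s [us sk sS]]]; exists (x :: s); split.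
- by rewrite /= us andbT; apply/negP => /sS[_ /=]; apply.
- by rewrite /= sk.
- by move=> y; rewrite inE => /orP[/eqP ->|/sS[]].
Qed.

Lemma exists_multiple_between (R : realType) (e a b : R) T :
  0 < e -> e^-1 < T%:R -> 0 <= a -> b <= 1 -> e < b - a ->
  exists2 t, (t < T)%N & a < t%:R * e < b.
Proof.
move=> e0 eT a0 b1 ab; have ae0 : 0 <= a / e by rewrite divr_ge0// ltW.
have := truncn_itv ae0; set t := Num.truncn _ => /andP[t1 t2].
have te : t%:R * e <= a by rewrite -ler_pdivlMr.
have te' : a < t.+1%:R * e by rewrite -ltr_pdivrMr.
have tb : t.+1%:R * e < b by rewrite -natr1 mulrDl mul1r; lra.
exists t.+1; last by rewrite te'.
rewrite -(ltr_nat R); apply: (lt_trans _ eT).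
by rewrite -[e^-1]mul1r ltr_pdivlMr// (lt_le_trans tb).
Qed.

(** * Lower bounds for separated sets *)

Section Counting.
Variable R : realType.
Implicit Types (x y z u v w p c : unit_itv R) (f g phi : unit_itv R -> unit_itv R).
Implicit Types (s t C : seq (unit_itv R)) (e : R).

Lemma le_max_separated f g n e t : strongly_commute f g -> 0 <= e -> uniq t ->
  {in t &, forall u v, u != v -> exists2 i, (i <= n)%N &
     e < `|\val (antidiagonal f g n u i) - \val (antidiagonal f g n v i)|} ->
  ((size t)%:R%:E <= max_separated (setfun_comp_inv g f) n.+1 e)%E.
Proof.
move=> fg e0 ut tsep.
pose X u := [tuple antidiagonal f g n u i | i < n.+1].
have XE u (i : 'I_n.+1) : tnth (X u) i = antidiagonal f g n u i by rewrite tnth_mktuple.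
have Xinj : {in t &, injective X}.
  move=> u v ut' vt Xuv; apply/eqP; apply: contrapT => /negP /(tsep u v ut' vt)[i iN].
  have iN' : (i < n.+1)%N by [].
  have := congr1 (fun h => tnth h (Ordinal iN')) Xuv; rewrite !XE /= => ->.
  by rewrite subrr normr0 ltNge e0.
apply: ereal_sup_ubound; exists (size t) => //=.
exists [set` map X t]; last first.
  by rewrite -(size_map X); apply: card_eq_uniq; rewrite map_inj_in_uniq.
split=> [_ /= /mapP[u uI ->] i j ij|_ _ /= /mapP[u uI ->] /mapP[v vI ->] uv].
  by rewrite !XE ij; apply: antidiagonal_orbit; rewrite // -ltnS -ij.
have [|i iN ei] := tsep u v uI vI; first by apply/eqP => uv'; apply: uv; rewrite uv'.
by exists (Ordinal (iN : (i < n.+1)%N)); rewrite !XE.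
Qed.

Lemma max_separated_ge1 f g n e : strongly_commute f g -> 0 <= e ->
  (1 <= max_separated (setfun_comp_inv g f) n.+1 e)%E.
Proof.
move=> fg e0; apply: (@le_max_separated f g n e [:: clamp 0]) => // u v.
by rewrite !inE => /eqP -> /eqP ->; rewrite eqxx.
Qed.

Lemma le_mul_max_separated f g n e s t m : strongly_commute f g -> 0 <= e -> uniq t ->
  {in t &, forall u v, u != v -> exists2 i, (i <= n)%N &
     e < `|\val (antidiagonal f g n u i) - \val (antidiagonal f g n v i)|} ->
  (size s <= m * size t)%N ->
  ((size s)%:R%:E <= m%:R%:E * max_separated (setfun_comp_inv g f) n.+1 e)%E.
Proof.
move=> fg e0 ut tsep st; apply: (@le_trans _ _ (m%:R%:E * (size t)%:R%:E)%E).
  by rewrite -EFinM lee_fin -natrM ler_nat.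
by apply: lee_wpmul2l; [rewrite lee_fin|exact: le_max_separated].
Qed.

(** Surjectivity of [f] writes the common value of [iter n g] on [s] as [iter n f p]. Each [u] in
    [s] then lifts to a [z] whose antidiagonal starts at [u] and ends at [p]. *)
Lemma size_fiber_r f g k e n s : strongly_commute f g -> (0 < k)%N -> 0 <= e ->
  (forall y, exists x, f x = y) -> two_to_one_within (e + e) (iter k g) ->
  uniq s -> {in s &, forall u v, iter n g u = iter n g v} ->
  ((size s)%:R%:E <=
    (2 ^ (n %/ k).+1)%:R%:E * max_separated (setfun_comp_inv g f) n.+1 e)%E.
Proof.
move=> fg k0 e0 fsurj g2 us gs.
have fnsurj y : exists x, iter n f x = y.
  elim: (n) y => [|i IH] y; first by exists y.
  by have [x <-] := fsurj y; have [w <-] := IH x; exists w.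
have [p pP] : exists p, {in s, forall u, iter n f p = iter n g u}.
  case: (s) gs => [|u s'] gs; first by exists (clamp 0).
  have [p pu] := fnsurj (iter n g u).
  by exists p => v vI; rewrite pu; apply: gs; rewrite ?mem_head.
have /choice[h hP] u : exists z, u \in s -> iter n f z = u /\ iter n g z = p.
  have [uI|] := boolP (u \in s); last by exists u.
  by have [z ?] := (strongly_commute_iter n n fg).2 u p (esym (pP u uI)); exists z.
have hu : uniq (map h s).
  by rewrite map_inj_in_uniq// => u v uI vI huv; rewrite -(hP u uI).1 huv (hP v vI).1.
have [||t [ut tsep st]] := @size_separated _ f g k e n (map h s) p fg k0 g2 hu.
- by move=> _ /mapP[u uI ->]; have [] := hP u uI.
- move=> _ _ /mapP[u uI ->] /mapP[v vI ->].
  by have [-> _] := hP u uI; have [-> _] := hP v vI; move=> ->.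
- by apply: (le_mul_max_separated fg e0 ut tsep); rewrite size_map in st.
Qed.

(* Here the common value must lie in the image of [iter n g], unlike in
   [size_fiber_r], because [g] is not assumed surjective. *)
Lemma size_fiber_l f g k e n s p : strongly_commute f g -> (0 < k)%N -> 0 <= e ->
  two_to_one_within (e + e) (iter k f) ->
  uniq s -> {in s, forall u, iter n f u = iter n g p} ->
  ((size s)%:R%:E <=
    (2 ^ (n %/ k).+1)%:R%:E * max_separated (setfun_comp_inv g f) n.+1 e)%E.
Proof.
move=> fg k0 e0 f2 us fs.
have /choice[h hP] u : exists z, u \in s -> iter n f z = p /\ iter n g z = u.
  have [uI|] := boolP (u \in s); last by exists u.
  by have [z ?] := (strongly_commute_iter n n fg).2 p u (esym (fs u uI)); exists z.
have hu : uniq (map h s).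
  by rewrite map_inj_in_uniq// => u v uI vI huv; rewrite -(hP u uI).2 huv (hP v vI).2.
have gf := strongly_commute_sym fg.
have [||t [ut tsep st]] := @size_separated _ g f k e n (map h s) p gf k0 f2 hu.
- by move=> _ /mapP[u uI ->]; have [] := hP u uI.
- move=> _ _ /mapP[u uI ->] /mapP[v vI ->].
  by have [_ ->] := hP u uI; have [_ ->] := hP v vI; move=> ->.
- apply: (le_mul_max_separated fg e0 ut) => [u v uI vI uv|]; last by rewrite size_map in st.
  (* Separation is known for the pair [(g, f)]; exchanging the maps reverses the antidiagonal, hence
     the index [n - i]. *)
  have [i iN ei] := tsep u v uI vI uv; exists (n - i)%N; first exact: leq_subr.
  by rewrite -!(antidiagonal_rev _ gf).
Qed.

(** The images [g^n(I)] decrease, so each of the finitely many points of [C] lies in all of them or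
    drops out at some stage; [m] dominates these stages. *)
Lemma iter_image_stable g C : exists m, {in C, forall c,
  (exists w, iter m g w = c) -> forall n, exists w, iter n g w = c}.
Proof.
have mono m n c : (m <= n)%N -> (exists w, iter n g w = c) -> exists w, iter m g w = c.
  by move=> mn [w <-]; exists (iter (n - m) g w); rewrite -iterD subnKC.
elim: C => [|c C [m mP]]; first by exists 0%N.
have [call|/existsNP[n nP]] := pselect (forall n, exists w, iter n g w = c).
  by exists m => d; rewrite inE => /orP[/eqP -> _|/mP].
exists (maxn m n) => d; rewrite inE => /orP[/eqP ->|dC] dw.
  by case: nP; apply: mono dw; exact: leq_maxr.
by apply: mP => //; apply: mono dw; exact: leq_maxl.
Qed.

Lemma image_convex phi a b x : continuous phi ->
  \val (phi a) <= \val x <= \val (phi b) -> exists w, phi w = x.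
Proof.
move=> cphi; have [e|/eqP xa] := eqVneq (phi a) x; first by exists a.
have [e|/eqP xb] := eqVneq (phi b) x; first by exists b.
rewrite !le_eqVlt => /andP[/orP[/eqP/val_inj//|ax] /orP[/eqP/val_inj/esym//|bx]].
have ab : a <> b by move=> ab; move: (lt_trans ax bx); rewrite ab ltxx.
have abx := lt_trans ax bx.
case: (total_unit_itv ab) => lt.
  have [|w _ /val_inj <-] := @unit_itv_ivt _ phi a b (\val x) cphi lt; last by exists w.
  by rewrite (min_idPl (ltW abx)) (max_idPr (ltW abx)) ax.
have [|w _ /val_inj <-] := @unit_itv_ivt _ phi b a (\val x) cphi lt; last by exists w.
by rewrite (min_idPr (ltW abx)) (max_idPl (ltW abx)) ax.
Qed.

(* The layer [g^m(I) \ g^n(I)] is fully [f]-invariant, and the choice of [m] in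
   [iter_image_stable] leaves no fold of [f] in it. *)
Lemma injective_iter_layer f g C m n j u v : strongly_commute f g ->
  continuous f -> injective_off C f ->
  {in C, forall c, (exists w, iter m g w = c) -> exists w, iter n g w = c} ->
  \val u < \val v ->
  (forall x, \val u <= \val x <= \val v ->
     (exists w, iter m g w = x) /\ ~ exists w, iter n g w = x) ->
  iter j f u <> iter j f v.
Proof.
move=> fg cf Cf Cm; elim: j u v => [|j IH] u v uv layer.
  by move=> /= e; rewrite e ltxx in uv.
rewrite !iterSr.
have fuv : f u <> f v.
  apply: Cf => // c cC; apply/negP => /andP[uc cv].
  have [|cm cn] := layer c; first by rewrite !ltW.
  exact: cn (Cm c cC cm).
(* The interval between [f u] and [f v] is again in the layer: commutation keeps its points in
   [g^m(I)], and the lifting clause would carry membership in [g^n(I)] back from [f w] to [w]. *)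
have flayer x : Num.min (\val (f u)) (\val (f v)) <= \val x <= Num.max (\val (f u)) (\val (f v)) ->
    (exists w, iter m g w = x) /\ ~ exists w, iter n g w = x.
  move=> fx; have [w uwv <-] : exists2 w, \val u <= \val w <= \val v & f w = x.
    have [<-|/eqP xu] := eqVneq (f u) x; first by exists u; rewrite ?lexx ?ltW.
    have [<-|/eqP xv] := eqVneq (f v) x; first by exists v; rewrite ?lexx ?ltW.
    have [|w /andP[uw wv] /val_inj <-] := unit_itv_ivt (r := \val x) cf uv; last first.
      by exists w => //; rewrite !ltW.
    move: fx => /andP[]; rewrite ge_min le_max gt_min lt_max !le_eqVlt.
    case/orP => [/orP[/eqP/val_inj//|->]|/orP[/eqP/val_inj//|->]];
    by case/orP => [/orP[/eqP/val_inj/esym//|->]|/orP[/eqP/val_inj/esym//|->]]; rewrite ?orbT.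
  have [[a aw] nw] := layer w uwv; split.
    by exists (f a); rewrite -aw -(strongly_commute_iter 1 m fg).1.
  move=> [b bfw]; apply: nw.
  by have [x' [_ xw]] := (strongly_commute_iter 1 n fg).2 b w bfw; exists x'.
case: (total_unit_itv fuv) => lt.
  by apply: IH => // x fx; apply: flayer; rewrite (min_idPl (ltW lt)) (max_idPr (ltW lt)).
apply: nesym; apply: IH => // x fx; apply: flayer.
by rewrite (min_idPr (ltW lt)) (max_idPl (ltW lt)).
Qed.

(** Two layer points with the same image under [iter j f] have a point of [g^n(I)] between them, by
    [injective_iter_layer]. Among three, the middle one would be enclosed by points of the interval
    [g^n(I)] and so lie in it. *)
Lemma size_fiber_layer f g C m n j s : strongly_commute f g ->
  continuous f -> continuous g -> injective_off C f ->
  {in C, forall c, (exists w, iter m g w = c) -> exists w, iter n g w = c} ->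
  uniq s -> {in s, forall x, (exists w, iter m g w = x) /\ ~ exists w, iter n g w = x} ->
  {in s &, forall x y, iter j f x = iter j f y} -> (size s <= 2)%N.
Proof.
move=> fg cf cg Cf Cm us slayer sf; rewrite leqNgt; apply/negP.
move=> /(ordered_triple us)[u [v [w [uI vI wI uv vw]]]].
have hit x y : x \in s -> y \in s -> \val x < \val y ->
    exists2 a, \val x <= \val a <= \val y & exists w, iter n g w = a.
  move=> xI yI xy; apply: contrapT => nh.
  apply: (injective_iter_layer (j := j) fg cf Cf Cm xy _ (sf x y xI yI)) => a xay; split.
    have [[x' xE] _] := slayer x xI; have [[y' yE] _] := slayer y yI.
    by apply: (@image_convex _ x' y'); [exact: continuous_iter|rewrite xE yE].
  by move=> an; apply: nh; exists a.
have [a' /andP[_ av] [a aE]] := hit u v uI vI uv.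
have [b' /andP[vb _] [b bE]] := hit v w vI wI vw.
have [_] := slayer v vI; apply.
by apply: (@image_convex _ a b); [exact: continuous_iter|rewrite aE bE av vb].
Qed.

End Counting.

(** * Upper bound for separated sets *)

Section UpperCount.
Variable R : realType.
Implicit Types (f g : unit_itv R -> unit_itv R).

(** [T] multiples of [e] cover the interval, [B i * A (n - i)] bounds the fibers of coordinate [i],
    and the leading 1 comes from interlacing. *)
Lemma max_separated_le f g (A B : nat -> R) n (e : R) T : strongly_commute f g ->
  continuous f -> continuous g ->
  (forall i, fiber_bound (iter i f) (A i)) -> (forall i, fiber_bound (iter i g) (B i)) ->
  0 < e -> e^-1 < T%:R ->
  (max_separated (setfun_comp_inv g f) n.+1 e <=
    (1 + T%:R * \sum_(i <- iota 0 n.+1) B i * A (n - i)%N)%:E)%E.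
Proof.
move=> fg cf cg fA gB e0 eT.
have B0 i : 0 <= B i by exact: (gB i [::]).
apply: ge_ereal_sup => _ /= [k [S [Sorb Ssep] Sk] <-].
have [s [us sk sS]] := uniq_card_eq Sk.
have /choice[h hP] x : exists z, x \in s -> forall i : 'I_n.+1, tnth x i = antidiagonal f g n z i.
  have [xs|] := boolP (x \in s); last by exists (clamp 0).
  have [|z zP] := @setfun_comp_inv_orbit _ f g n (fun i => tnth x (inord i)) fg.
    by move=> i iN; apply: (Sorb x (sS x xs)); rewrite !inordK// ltnW.
  by exists z => _ i; rewrite -zP ?inord_val// -ltnS.
have hinj : {in s &, injective h}.
  by move=> x y xs ys xy; apply: eq_from_tnth => i; rewrite !hP// xy.
(* A grid element is a coordinate together with a multiple of [e]; [W] picks between two base points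
   a point where that coordinate takes that value. *)
pose grid := [seq (i, t) | i <- iota 0 n.+1, t <- iota 0 T].
pose phi i z := antidiagonal f g n z i.
have /choice[W WP] (zz : unit_itv R * unit_itv R) : exists w,
    zz.1 \in map h s -> zz.2 \in map h s -> \val zz.1 < \val zz.2 ->
    between zz.1 zz.2 w /\ exists it, it \in grid /\ \val (phi it.1 w) = it.2%:R * e.
  case: zz => u v /=; have [/mapP[x xs ->]|_] := boolP (u \in _); last by exists u.
  have [/mapP[y ys ->]|_] := boolP (v \in _); last by exists v.
  have [xy|_] := boolP (\val (h x) < \val (h y)); last by exists u.
  have [|i] := Ssep x y (sS x xs) (sS y ys); first by move=> xyE; rewrite xyE ltxx in xy.
  rewrite !hP// => ei.
  have [t tT tb] : exists2 t, (t < T)%N &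
      Num.min (\val (phi i (h x))) (\val (phi i (h y))) < t%:R * e <
      Num.max (\val (phi i (h x))) (\val (phi i (h y))).
    have /andP[x0 x1] := val_unit_itv (phi i (h x)).
    have /andP[y0 y1] := val_unit_itv (phi i (h y)).
    move: ei; rewrite -/(phi i (h x)) -/(phi i (h y)).
    case: (leP (\val (phi i (h x))) (\val (phi i (h y)))) => le; move=> ei.
      apply: exists_multiple_between => //.
      by move: ei; rewrite /mdist /= distrC ger0_norm// subr_ge0.
    apply: exists_multiple_between => //.
    by move: ei; rewrite /mdist /= ger0_norm// subr_ge0 ltW.
  have [|w w1 w2] := unit_itv_ivt (phi := phi i) _ xy tb.
    move=> z; apply: (@continuous_comp _ _ _ (iter i g) (iter (n - i) f)); exact: continuous_iter.
  exists w => _ _ _; split => //; exists (i : nat, t); split => //.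
  by apply: allpairs_f; rewrite mem_iota//= add0n.
pose Ws := undup [seq W zz | zz <- [seq (u, v) | u <- map h s, v <- map h s] & \val zz.1 < \val zz.2].
have sW : (size (map h s) <= (size Ws).+1)%N.
  apply: size_interlaced => [|u v uI vI uv]; first by rewrite map_inj_in_uniq.
  have [wuv _] := WP (u, v) uI vI uv; exists (W (u, v)) => //.
  rewrite mem_undup; apply: map_f; rewrite mem_filter uv /=.
  exact: allpairs_f.
have /choice[H HP] w : exists it, w \in Ws -> it \in grid /\ \val (phi it.1 w) = it.2%:R * e.
  have [|_] := boolP (w \in Ws); last by exists (0%N, 0%N).
  rewrite mem_undup => /mapP[zz]; rewrite mem_filter => /andP[lt /allpairsP[[u v] /= [uI vI zzE]]] ->.
  rewrite zzE /= in lt *; have [_ [it ?]] := WP (u, v) uI vI lt.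
  by exists it.
have Wle : (size Ws)%:R <= \sum_(it <- grid) B it.1 * A (n - it.1)%N.
  apply: (size_le_sum_fibers (h := H)) => [w /HP[]//|[i t] _ /=].
  rewrite -size_filter; apply: (fiber_bound_comp (B0 i) (gB i) (fA (n - i)%N)).
    exact/filter_uniq/undup_uniq.
  move=> u v; rewrite !mem_filter => /andP[/eqP Hu /HP[_ uE]] /andP[/eqP Hv /HP[_ vE]].
  by apply: val_inj; move: uE vE; rewrite Hu Hv /phi /antidiagonal /= => -> ->.
rewrite lee_fin -sk -(size_map h) (@le_trans _ _ (size Ws).+1%:R)// ?ler_nat//.
rewrite -natr1 addrC lerD2l (le_trans Wle)// big_allpairs_dep /= mulr_sumr.
apply: ler_sum => i _ /=.
by rewrite big_const_seq count_predT iter_addr_0 size_iota mulr_natl.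
Qed.
End UpperCount.

(** * Entropy as an exponential growth rate *)

Section EntropyRate.
Variable R : realType.
Implicit Types (F : unit_itv R -> set (unit_itv R)) (e l : R).
Local Open Scope ereal_scope.

Lemma le_lne (x y : \bar R) : x <= y -> lne x <= lne y.
Proof.
move=> xy; have [x0|x0] := leP x 0; first by rewrite (le0_lneNy x0) leNye.
by rewrite lee_lne// in_itv /= leey andbT ltW// (lt_le_trans x0).
Qed.

Lemma limn_esup_le (u : (\bar R)^nat) N x : (forall n, (N <= n)%N -> u n <= x) ->
  limn_esup u <= x.
Proof.
move=> ux; apply: (@le_trans _ _ (ereal_sup (u @` [set n | (N <= n)%N]))).
  by apply: ereal_inf_lbound; exists [set n | (N <= n)%N] => //; exists N.
by apply: ge_ereal_sup => _ /= [n Nn <-]; exact: ux.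
Qed.

Lemma limn_esup_lt (u : (\bar R)^nat) x : limn_esup u < x ->
  exists N, forall n, (N <= n)%N -> u n < x.
Proof.
move=> /ereal_inf_lt[_ /= [V [N _ NV] <-] Vx]; exists N => n Nn.
by apply: le_lt_trans Vx; apply: ereal_sup_ubound; exists n => //; exact: NV.
Qed.

Lemma le_limn_esup (u v : (\bar R)^nat) : (forall n, u n <= v n) ->
  limn_esup u <= limn_esup v.
Proof.
move=> uv; apply: le_ereal_inf_tmp => _ /= [V FV <-].
apply: (@le_trans _ _ (ereal_sup (u @` V))).
  by apply: ereal_inf_lbound; exists V.
apply: ge_ereal_sup => _ /= [n Vn <-]; apply: (le_trans (uv n)).
by apply: ereal_sup_ubound; exists n.
Qed.

Definition entropy_rate F e :=
  limn_esup (fun n => (n%:R^-1)%:E * lne (max_separated F n e)).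

(** The rate does not increase with [e], so the limit at [0^'+] is a supremum. *)
Lemma entropyE F : entropy F = ereal_sup [set entropy_rate F e | e in `]0%R, +oo[].
Proof.
apply: cvg_lim => //; apply: nonincreasing_at_right_cvge => // d e _ _ de.
apply: le_limn_esup => n; apply: lee_wpmul2l; first by rewrite lee_fin invr_ge0.
apply: le_lne; apply: le_ereal_sup => _ /= [k [S [Sorb Ssep] Sk] <-].
exists k => //; exists S => //; split => // x y Sx Sy xy.
by have [i ei] := Ssep x y Sx Sy xy; exists i; exact: le_lt_trans ei.
Qed.

Lemma entropy_le F x : (forall e, (0 < e)%R -> entropy_rate F e <= x) -> entropy F <= x.
Proof.
move=> Fx; rewrite entropyE; apply: ge_ereal_sup => _ /= [e e0 <-].
by apply: Fx; rewrite in_itv /= andbT in e0.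
Qed.

Lemma entropy_rate_le F e : (0 < e)%R -> entropy_rate F e <= entropy F.
Proof.
by move=> e0; rewrite entropyE; apply: ereal_sup_ubound; exists e; rewrite //= in_itv /= e0.
Qed.

Lemma entropy_lt_growth F e l : (0 < e)%R -> entropy F < l%:E ->
  exists N, forall n, (N <= n)%N -> max_separated F n e <= (expR (l * n%:R))%:E.
Proof.
move=> e0 Fl; have [N NP] := limn_esup_lt (le_lt_trans (entropy_rate_le F e0) Fl).
exists N.+1 => n Nn; have := NP n (ltnW Nn).
have n1 : (0 < n%:R :> R)%R by rewrite ltr0n (leq_ltn_trans _ Nn).
have n0 : (0 < n%:R^-1 :> R)%R by rewrite invr_gt0.
(* Nonpositive values have logarithm [-oo] and are treated apart; the value [+oo] contradicts the
   strict bound. *)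
case: (max_separated F n e) => [r| |] /=; last by rewrite leNye.
  case: ifPn => [r0 _|]; first by rewrite lee_fin (le_trans r0)// expR_ge0.
  rewrite -ltNge => r0; rewrite -EFinM lte_fin mulrC ltr_pdivrMr// => /ltW rn.
  by rewrite lee_fin -[r]lnK ?posrE// ler_expR.
by rewrite gt0_muley ?lte_fin// ltNge leey.
Qed.

Lemma growth_entropy_le F l : (forall e, (0 < e)%R ->
    exists N, forall n, (N <= n)%N -> max_separated F n e <= (expR (l * n%:R))%:E) ->
  entropy F <= l%:E.
Proof.
move=> Fl; apply: entropy_le => e /Fl[N NP]; apply: (@limn_esup_le _ N.+1) => n Nn.
have n0 : (0 < n%:R :> R)%R by rewrite ltr0n (leq_ltn_trans _ Nn).
apply: (@le_trans _ _ ((n%:R^-1)%:E * (l * n%:R)%:E)).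
  apply: lee_wpmul2l; first by rewrite lee_fin invr_ge0 ltW.
  by rewrite (le_trans (le_lne (NP n (ltnW Nn))))// lne_EFin ?expR_gt0// expRK.
by rewrite -EFinM mulrC mulfK// gt_eqF.
Qed.

End EntropyRate.

(** * Growth of fibers versus entropy *)

Section Growth.
Variable R : realType.
Implicit Types (f g phi : unit_itv R -> unit_itv R) (l d : R).

Definition fiber_growth phi l :=
  exists C, forall n, fiber_bound (iter n phi) (C * expR (l * n%:R)).

(** Tested on a singleton, the bound for [phi] is at least 1, which is all that the identity
    requires. *)
Lemma fiber_growth_id phi l : fiber_growth phi l -> fiber_growth id l.
Proof.
move=> [C hC]; exists C => n s us sid.
have iter_id (x : unit_itv R) : iter n id x = x by elim: (n) => //= m ->.
case: s us sid => [_ _|x s us sid]; first exact: (hC n [::]).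
suff -> : s = [::] by apply: (hC n [:: x]) => // u v; rewrite !inE => /eqP -> /eqP ->.
case: s us sid => [//|y s] /= us /(_ x y); rewrite !iter_id !inE !eqxx orbT => /(_ isT isT) xy.
by move: us; rewrite xy inE eqxx.
Qed.

Lemma fiber_growth_eventually phi l C N :
  (forall n, exists A : R, fiber_bound (iter n phi) A) ->
  (forall n, (N <= n)%N -> fiber_bound (iter n phi) (C * expR (l * n%:R))) ->
  fiber_growth phi l.
Proof.
move=> fin; elim: N C => [|N IH] C hC; first by exists C => n; exact: hC.
have [A hA] := fin N.
apply: (IH (Num.max C (A / expR (l * N%:R)))) => n.
rewrite leq_eqVlt => /orP[/eqP <- s us /(hA s us)/le_trans|nN s us /(hC n nN s us)/le_trans]; apply.
  by rewrite -ler_pdivrMr ?expR_gt0// le_max lexx orbT.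
by rewrite ler_pM2r ?expR_gt0// le_max lexx.
Qed.

Lemma fiber_growth_entropy f g l d : strongly_commute f g ->
  continuous f -> continuous g -> fiber_growth f l -> fiber_growth g l -> 0 < d ->
  (entropy (setfun_comp_inv g f) <= (l + d)%:E)%E.
Proof.
move=> fg cf cg [A fA] [B gB] d0; apply: growth_entropy_le => e e0.
pose T := (Num.truncn e^-1).+1.
(* The summand [A] absorbs the leading 1, since [1 <= A * expR (l * m)]. *)
pose D := A + T%:R * (B * A).
have fA1 n : 1 <= A * expR (l * n%:R).
  by apply: (fA n [:: clamp 0]) => // u v; rewrite !inE => /eqP -> /eqP ->.
(* For [n >= N] this gives [D * expR (- l) * n <= (d * n / 2) ^ 2 <= expR (d * n)], so the slack [d]
   swallows the linear factor. The factor [expR (- l)] reflects [m = n - 1]. *)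
pose N := (Num.truncn (4 * (D * expR (- l)) / d ^+ 2)).+1.
exists N => -[|m] // Nm.
have eT : e^-1 < T%:R by exact: truncnS_gt.
apply: (le_trans (max_separated_le m fg cf cg fA gB e0 eT)).
rewrite lee_fin; set n := m.+1.
have -> : \sum_(i <- iota 0 n) B * expR (l * i%:R) * (A * expR (l * (m - i)%:R)) =
    (B * A) * expR (l * m%:R) * n%:R.
  rewrite (eq_big_seq (fun=> B * A * expR (l * m%:R))) => [|i].
    by rewrite big_const_seq count_predT iter_addr_0 size_iota -[LHS]mulr_natr.
  rewrite mem_iota add0n /= ltnS => im.
  by rewrite mulrACA -expRD -mulrDr -natrD subnKC.
have n1 : 1 <= n%:R :> R by rewrite ler1n.
have nD : 1 + T%:R * (B * A * expR (l * m%:R) * n%:R) <= D * expR (l * m%:R) * n%:R.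
  rewrite /D mulrDl mulrDl -!mulrA lerD2r.
  have := fA1 m; rewrite mulrA => h; rewrite (le_trans h)// ler_peMr//.
  exact: le_trans ler01 h.
apply: (le_trans nD).
have -> : l * m%:R = l * n%:R - l by rewrite /n -natr1; ring.
have -> : D * expR (l * n%:R - l) * n%:R = expR (l * n%:R) * (D * expR (- l) * n%:R).
  by rewrite expRD; ring.
rewrite [(l + d) * _]mulrDl expRD ler_wpM2l ?expR_ge0//.
have Nn : 4 * (D * expR (- l)) / d ^+ 2 < n%:R.
  by apply: (lt_le_trans (truncnS_gt _)); rewrite ler_nat.
rewrite ltr_pdivrMr ?exprn_gt0// in Nn.
have xe : (d * n%:R / 2) ^+ 2 <= expR (d * n%:R).
  have -> : expR (d * n%:R) = expR (d * n%:R / 2) ^+ 2.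
    by rewrite expr2 -expRD; congr expR; lra.
  have x0 : 0 <= d * n%:R / 2 by rewrite divr_ge0// mulr_ge0// ltW.
  by rewrite ler_sqr ?nnegrE ?expR_ge0// (le_trans _ (expR_ge1Dx _))// lerDr.
apply: (le_trans _ xe).
have n0 : 0 < n%:R :> R by rewrite ltr0n.
rewrite -subr_ge0.
have -> : (d * n%:R / 2) ^+ 2 - D * expR (- l) * n%:R =
  n%:R * (n%:R * d ^+ 2 - 4 * (D * expR (- l))) / 4 by field.
by rewrite divr_ge0// mulr_ge0 ?(ltW n0)// subr_ge0 ltW.
Qed.

(** With [l'] strictly between the entropy and [l], a large [k] makes the loss [2 ^ (n %/ k)] at
    most [expR ((l - l') * n)]. [K] allows for a further loss independent of [n]. *)
Lemma entropy_lt_fiber_growth phi (F : unit_itv R -> set (unit_itv R)) l (K : nat) :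
  (forall n, exists A : R, fiber_bound (iter n phi) A) ->
  (forall k, (0 < k)%N -> exists2 e, 0 < e & forall n s, uniq s ->
    {in s &, forall u v, iter n phi u = iter n phi v} ->
    ((size s)%:R%:E <= (K * 2 ^ (n %/ k).+1)%:R%:E * max_separated F n.+1 e)%E) ->
  (entropy F < l%:E)%E -> fiber_growth phi l.
Proof.
move=> fin hK Fl.
have [l' Fl' ll'] : exists2 l', (entropy F < l'%:E)%E & l' < l.
  case: (entropy F) Fl => [r| |] //=; last by exists (l - 1); rewrite ?ltNyr//; lra.
  by rewrite lte_fin => rl; exists ((r + l) / 2); rewrite ?lte_fin; lra.
pose d := l - l'; have d0 : 0 < d by rewrite subr_gt0.
(* From [k > 1 / d] follows [2 <= 1 + d * k <= expR (d * k)]. *)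
pose k := (Num.truncn d^-1).+1.
have dk : 2 <= expR (d * k%:R).
  apply: le_trans (expR_ge1Dx _).
  have : d^-1 < k%:R by exact: truncnS_gt.
  by rewrite -(ltr_pM2l d0) mulfV ?gt_eqF//; lra.
have [e e0 he] := hK k isT.
have [N NP] := entropy_lt_growth e0 Fl'.
(* The 2 comes from the successor in the exponent, [expR l'] from orbits having [n.+1] entries. *)
apply: (@fiber_growth_eventually _ _ (K%:R * 2 * expR l') N) => // n Nn s us sphi.
have := he n s us sphi.
have KP : (0 <= (K * 2 ^ (n %/ k).+1)%:R%:E :> \bar R)%E by rewrite lee_fin.
move/le_trans => /(_ _ (lee_wpmul2l KP (NP n.+1 (leqW Nn)))).
rewrite -EFinM lee_fin => /le_trans; apply.
have -> : K%:R * 2 * expR l' * expR (l * n%:R) =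
    K%:R * 2 * (expR (d * n%:R) * expR (l' * n.+1%:R)).
  by rewrite -[LHS]mulrA -!expRD /d -natr1; congr (_ * expR _); ring.
rewrite natrM natrX exprS [K%:R * _]mulrA -[leLHS]mulrA.
rewrite ler_wpM2l ?mulr_ge0// ler_wpM2r ?expR_ge0//.
apply: (@le_trans _ _ (expR (d * k%:R) ^+ (n %/ k))).
  by rewrite lerXn2r ?nnegrE ?expR_ge0.
rewrite -expRM_natl ler_expR mulrCA ler_wpM2l ?(ltW d0)//.
by rewrite -natrM ler_nat leq_trunc_div.
Qed.

Lemma entropy_lt_fiber_growth_lr f g l :
  piecewise_monotone f -> piecewise_monotone g -> strongly_commute f g ->
  (forall y, exists x, f x = y) ->
  (entropy (setfun_comp_inv g f) < l%:E)%E -> fiber_growth f l /\ fiber_growth g l.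
Proof.
move=> pf pg fg fsurj Fl.
have [[cf _] [cg _]] := (pf, pg).
have [Cf fC] := piecewise_monotone_injective_off pf.
have [Cg gC] := piecewise_monotone_injective_off pg.
have fin phi C : continuous phi -> injective_off C phi ->
    forall n, exists A : R, fiber_bound (iter n phi) A.
  move=> cphi phiC n; have [D phiD] := injective_off_iter n cphi phiC.
  exists (size D).+1%:R => s us sphi; rewrite ler_nat.
  exact: (injective_off_fiber phiD).
have two phi C : continuous phi -> injective_off C phi -> forall k,
    exists2 e : R, 0 < e & two_to_one_within (e + e) (iter k phi).
  move=> cphi phiC k; have [D phiD] := injective_off_iter k cphi phiC.
  have [e e0 h] := injective_off_two_to_one phiD.
  by exists (e / 2); [rewrite divr_gt0|rewrite -splitr].
split; last first.
  apply: (entropy_lt_fiber_growth (K := 1) (fin g Cg cg gC) _ Fl) => k k0.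
  have [e e0 g2] := two g Cg cg gC k; exists e => // n s us sg.
  by rewrite mul1n; apply: size_fiber_r => //; exact: ltW.
have [m mP] := iter_image_stable g Cf.
have [D gmD] := injective_off_iter m cg gC.
apply: (entropy_lt_fiber_growth (K := (size D).+1) (fin f Cf cf fC) _ Fl) => k k0.
have [e e0 f2] := two f Cf cf fC k; exists e => // n s us sf.
have gmA : fiber_bound (iter m g) ((size D).+1%:R : R).
  by move=> t ut tg; rewrite ler_nat; exact: (injective_off_fiber gmD).
(* Passing to the image under [iter m g] costs a factor [(size D).+1] independent of [n], and moves
   the fiber into [g^m(I)]. *)
set s' := undup (map (iter m g) s).
have sf' : {in s' &, forall x y, iter n f x = iter n f y}.
  move=> _ _ /[!mem_undup] /mapP[u uI ->] /mapP[v vI ->].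
  by rewrite !(strongly_commute_iter n m fg).1 (sf u v uI vI).
suff s'le : ((size s')%:R%:E <=
    (2 ^ (n %/ k).+1)%:R%:E * max_separated (setfun_comp_inv g f) n.+1 e)%E.
  apply: (@le_trans _ _ ((size D).+1%:R%:E * (size s')%:R%:E)%E).
    by rewrite -EFinM lee_fin; exact: fiber_bound_size.
  by rewrite natrM EFinM -muleA lee_wpmul2l// lee_fin.
(* Either the common value under [iter n f] lies in [g^n(I)] and [size_fiber_l] applies, or no point
   of [s'] lies in [g^n(I)] and the layer holds at most two of them. *)
have [[p pP]|np] := pselect (exists p, {in s', forall x, iter n f x = iter n g p}).
  by apply: (size_fiber_l (p := p)) => //; [exact: ltW|exact: undup_uniq].
have s'2 : (size s' <= 2)%N.
  apply: (@size_fiber_layer _ f g Cf m n n) => //; first by move=> c cC /(mP c cC); apply.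
    exact: undup_uniq.
  move=> x xs'; split; first by move: xs'; rewrite mem_undup => /mapP[u _ ->]; exists u.
  move=> [w gw]; apply: np; exists (iter n f w) => y ys'.
  by rewrite (sf' y x ys' xs') -gw (strongly_commute_iter n n fg).1.
apply: (@le_trans _ _ ((2 ^ (n %/ k).+1)%:R%:E * 1)%E).
  rewrite mule1 lee_fin ler_nat (leq_trans s'2)//.
  by rewrite expnS leq_pmulr// expn_gt0.
by rewrite lee_wpmul2l// ?lee_fin//; apply: max_separated_ge1 => //; exact: ltW.
Qed.

Lemma piecewise_monotone_id : piecewise_monotone (@id (unit_itv R)).
Proof.
split; first by move=> x; exact: cvg_id.
exists 1%N, (fun i => i%:R); split=> // [[]//|i _].
by move=> x y _ _.
Qed.

Lemma setfunE (T : Type) (phi : T -> T) : setfun phi = setfun_comp_inv phi id.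
Proof.
by apply/funext => x; apply/seteqP; split=> [y ->|_ [z -> <-]]//; exists x.
Qed.

Lemma fiber_growth_entropy_setfun f l d : piecewise_monotone f ->
  fiber_growth f l -> 0 < d -> (entropy (setfun f) <= (l + d)%:E)%E.
Proof.
move=> [cf _] fl d0; rewrite setfunE; apply: fiber_growth_entropy => //.
- exact: strongly_commute_id.
- by have [] := piecewise_monotone_id.
- exact: fiber_growth_id fl.
Qed.

Lemma entropy_setfun_lt_fiber_growth f l : piecewise_monotone f ->
  (entropy (setfun f) < l%:E)%E -> fiber_growth f l.
Proof.
rewrite setfunE => pf fl; apply: (entropy_lt_fiber_growth_lr _ pf _ _ fl).2 => //.
- exact: piecewise_monotone_id.
- exact: strongly_commute_id.
- by move=> y; exists y.
Qed.

(** Testing with real [l] above [y] and a slack [d] avoids arithmetic with infinite entropies. *)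
Lemma lee_lt_addgt0 (x y : \bar R) :
  (forall l d : R, (y < l%:E)%E -> 0 < d -> (x <= (l + d)%:E)%E) -> (x <= y)%E.
Proof.
move=> xy; case: y xy => [r xy| _|xy].
- apply/lee_addgt0Pr => e e0; rewrite -EFinD.
  rewrite [e]splitr addrA; apply: xy; last by rewrite divr_gt0.
  by rewrite lte_fin ltrDl divr_gt0.
- by rewrite leey.
- case: x xy => [r xy|xy|//]; last by have := xy 0 1 (ltNyr _) ltr01.
  by have := xy (r - 2) 1 (ltNyr _) ltr01; rewrite lee_fin => {xy} h; exfalso; lra.
Qed.
End Growth.

Theorem corollary5p5 (R : realType) (f g : unit_itv R -> unit_itv R)
    (hf : piecewise_monotone f) (hg : piecewise_monotone g)
    (f_surj : set_surj [set: unit_itv R] [set: unit_itv R] f)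
    (fg_comm : setfun_comp_inv g f = setfun_inv_comp f g) :
  entropy (setfun_comp_inv g f) =
    maxe (entropy (setfun f)) (entropy (setfun g)).
Proof.
have fg := setfun_comp_inv_strongly_commute fg_comm.
have fsurj y : exists x, f x = y by have [x _ <-] := f_surj y I; exists x.
(* In each inequality, entropy below [l] forces fibers to grow at rate at most [l], which bounds the
   other side by [l + d]. *)
apply/eqP; rewrite eq_le ge_max; apply/and3P; split; apply: lee_lt_addgt0 => l d.
- rewrite gt_max => /andP[/(entropy_setfun_lt_fiber_growth hf) fl].
  move=> /(entropy_setfun_lt_fiber_growth hg) gl d0.
  by apply: fiber_growth_entropy => //; [case: hf|case: hg].
- move=> /(entropy_lt_fiber_growth_lr hf hg fg fsurj)[fl _].
  exact: fiber_growth_entropy_setfun.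
- move=> /(entropy_lt_fiber_growth_lr hf hg fg fsurj)[_ gl].
  exact: fiber_growth_entropy_setfun.
Qed.
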